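(* Let $V$ be an $\ell$-Volterra quadratic stochastic operator on $S^{m-1}$ with associated coefficients $a_{ki}$. Let $1\le r\le \ell$, $r<m$, and suppose $a_{ki}<0$ for all $k=1,\dots,r$ and $i=r+1,\dots,m$. Then for every $x^0\in\mathrm{int}\,S^{m-1}$ and every $i\in\{1,\dots,r\}$, $x_i^{(n)}\to 0$ as $n\to\infty$ at the rate of a geometric progression, i.e. there exist $C>0$ and $\theta\in[0,1)$ (possibly depending on $x^0$) such that $x_i^{(n)}\le C\theta^n$ for all $n\ge 1$.
   Context: Let $E=\{1,\dots,m\}$, $S^{m-1}=\{x\in\mathbb{R}^m: x_i\ge 0,\ \sum_{i=1}^m x_i=1\}$, $\mathrm{int}\,S^{m-1}=\{x\in S^{m-1}:\prod_{i=1}^m x_i>0\}$. A quadratic stochastic operator is a map $V:S^{m-1}\to S^{m-1}$, $V(x)_k=\sum_{i,j=1}^m P_{ij,k}x_ix_j$, where $P_{ij,k}\ge 0$, $P_{ij,k}=P_{ji,k}$, $\sum_{k=1}^m P_{ij,k}=1$ for all $i,j,k\in E$. For a fixed $\ell\in E$, $V$ is called $\ell$-Volterra if (i) $P_{ij,k}=0$ whenever $k\in\{1,\dots,\ell\}$, $i,j\in E$ and $k\notin\{i,j\}$; and (ii) for every $k\in\{\ell+1,\dots,m\}$ there is at least one pair $(i,j)$ with $i\ne k$, $j\ne k$ and $P_{ij,k}>0$. Its associated coefficients are $a_{ki}=2P_{ik,k}-1$ for $k\ne i$ and $a_{kk}=P_{kk,k}-1$ ($k,i\in E$). For $k\le\ell$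 one then has $V(x)_k=x_k(1+\sum_{i=1}^m a_{ki}x_i)$. The trajectory of $x^0$ is $x^{(0)}=x^0$, $x^{(n+1)}=V(x^{(n)})$, and $x_i^{(n)}$ is the $i$-th coordinate of $x^{(n)}$. *)

(* Defs.v *)
From HB Require Import structures.
From mathcomp Require Import all_boot all_order all_algebra.
From mathcomp Require Import all_classical all_reals all_analysis.
Set Implicit Arguments.
Unset Strict Implicit.
Unset Printing Implicit Defensive.
Import Order.TTheory GRing.Theory Num.Theory.
Import numFieldNormedType.Exports.
Local Open Scope classical_set_scope.
Local Open Scope ring_scope.

(* The index set E = {1, ..., m} is rendered as 'I_m, the index i of E being
   the ordinal of value i - 1: "k in {1, ..., l}" reads "k < l" and
   "k in {l+1, ..., m}" reads "l <= k" for k : 'I_m. A point of R^m is a row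
   vector x : 'rV[R]_m with coordinates x 0 i, and the coefficient P_{ij,k} is
   P i j k. *)

Definition simplex (R : realType) (m : nat) : set 'rV[R]_m :=
  [set x | (forall i, 0 <= x 0 i) /\ \sum_(i < m) x 0 i = 1].

Definition int_simplex (R : realType) (m : nat) : set 'rV[R]_m :=
  [set x | simplex x /\ 0 < \prod_(i < m) x 0 i].

Definition qso_coefficients (R : realType) (m : nat)
    (P : 'I_m -> 'I_m -> 'I_m -> R) : Prop :=
  [/\ forall i j k, 0 <= P i j k,
      forall i j k, P i j k = P j i k
    & forall i j, \sum_(k < m) P i j k = 1].

(* Defined on all of R^m; [qso_simplex] shows that it restricts to a self-map
   of the simplex. *)
Definition qso (R : realType) (m : nat) (P : 'I_m -> 'I_m -> 'I_m -> R)
    (x : 'rV[R]_m) : 'rV[R]_m :=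
  \row_(k < m) \sum_(i < m) \sum_(j < m) P i j k * x 0 i * x 0 j.

Lemma qso_simplex (R : realType) (m : nat) (P : 'I_m -> 'I_m -> 'I_m -> R)
    (x : 'rV[R]_m) :
  qso_coefficients P -> simplex x -> simplex (qso P x).
Proof.
move=> [P0 _ P1] [x0 x1]; split=> [k|].
  rewrite mxE; apply: sumr_ge0 => i _; apply: sumr_ge0 => j _.
  by rewrite !mulr_ge0.
under eq_bigr do rewrite mxE.
rewrite exchange_big -[RHS]x1 /=; apply: eq_bigr => i _.
rewrite exchange_big /= -[RHS]mulr1 -x1 mulr_sumr; apply: eq_bigr => j _.
by rewrite -!mulr_suml P1 mul1r.
Qed.

Definition l_volterra (R : realType) (m : nat) (l : nat)
    (P : 'I_m -> 'I_m -> 'I_m -> R) : Prop :=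
  (forall k : 'I_m, (k < l)%N ->
     forall i j : 'I_m, k != i -> k != j -> P i j k = 0) /\
  (forall k : 'I_m, (l <= k)%N ->
     exists i j : 'I_m, [/\ i != k, j != k & 0 < P i j k]).

Definition assoc_coef (R : realType) (m : nat)
    (P : 'I_m -> 'I_m -> 'I_m -> R) (k i : 'I_m) : R :=
  if k == i then P k k k - 1 else 2 * P i k k - 1.

Definition trajectory (R : realType) (m : nat)
    (P : 'I_m -> 'I_m -> 'I_m -> R) (x0 : 'rV[R]_m) (n : nat) : 'rV[R]_m :=
  iter n (qso P) x0.

(* Main.v *)
Require Import Defs.
From mathcomp Require Import all_boot all_order all_algebra.
From mathcomp Require Import all_classical all_reals all_analysis.
From mathcomp Require Import ring lra.
Set Implicit Arguments.
Unset Strict Implicit.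
Unset Printing Implicit Defensive.
Import Order.TTheory GRing.Theory Num.Theory.
Import numFieldNormedType.Exports.
Local Open Scope classical_set_scope.
Local Open Scope ring_scope.

(** Let A = {1, ..., r} and let X be the total mass that x gives to A. The
    mass of V(x) on A is the sum of w i j * x_i * x_j, where w i j is the
    probability that parents i and j have their offspring in A, and
    since an offspring in A copies one of its parents, w i j is 0 when both
    parents are outside A, at most 1 when both are inside, and exactly P_{ij,i}
    when only i is inside. The last number is
    (1 + a_{ij}) / 2, so the sign hypothesis gives a single q < 1 with
    2 * P_{ij,i} <= q for all such pairs. Summing up
    ([mass_qso_le]),

      mass of V(x) on A <= X^2 + q X (1 - X) = X (X + q (1 - X)).

    The bracket is a convex combination of 1 and q, hence at most 1, so the
    mass on A never increases; the bracket is nondecreasing in X, so along the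
    trajectory it stays below its initial value theta = X_0 + q (1 - X_0).
    An interior starting point gives positive mass to the complement of A,
    which is nonempty as r < m; thus X_0 < 1 and theta < 1. The mass on A, and
    with it each coordinate in A, is O(theta ^ n). *)

Definition mass (R : realType) (m : nat) (A : {pred 'I_m}) (x : 'rV[R]_m) : R :=
  \sum_(k in A) x 0 k.

(** The copying condition of [l_volterra] with an arbitrary set of types in
    place of an initial segment: the decay argument follows the mass of any set
    on which offspring copy a parent. *)
Definition volterra_on (R : realType) (m : nat) (A : {pred 'I_m})
    (P : 'I_m -> 'I_m -> 'I_m -> R) : Prop :=
  forall k, k \in A -> forall i j, k != i -> k != j -> P i j k = 0.

Lemma mass_ge0 (R : realType) (m : nat) (A : {pred 'I_m}) (x : 'rV[R]_m) :
  simplex x -> 0 <= mass A x.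
Proof. by move=> [x_ge0 _]; apply: sumr_ge0. Qed.

Lemma mass_predC (R : realType) (m : nat) (A : {pred 'I_m}) (x : 'rV[R]_m) :
  simplex x -> \sum_(k | k \notin A) x 0 k = 1 - mass A x.
Proof. by move=> [_ <-]; rewrite [X in X - _](bigID (mem A)) /= addrAC subrr add0r. Qed.

Lemma mass_le1 (R : realType) (m : nat) (A : {pred 'I_m}) (x : 'rV[R]_m) :
  simplex x -> mass A x <= 1.
Proof.
move=> Sx; rewrite -subr_ge0 -mass_predC //.
by case: Sx => x_ge0 _; apply: sumr_ge0.
Qed.

Lemma coord_le_mass (R : realType) (m : nat) (A : {pred 'I_m}) (x : 'rV[R]_m)
    (i : 'I_m) :
  simplex x -> i \in A -> x 0 i <= mass A x.
Proof.
move=> [x_ge0 _] Ai; rewrite /mass (bigD1 i) //= lerDl.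
exact: sumr_ge0.
Qed.

Lemma int_simplex_mass_lt1 (R : realType) (m : nat) (A : {pred 'I_m})
    (x : 'rV[R]_m) (j : 'I_m) :
  int_simplex x -> j \notin A -> mass A x < 1.
Proof.
move=> [Sx /lt0r_neq0 /prodf_neq0 x_neq0] Aj.
rewrite -subr_gt0 -mass_predC // (bigD1 j) //=.
have [x_ge0 _] := Sx.
by rewrite ltr_wpDr ?sumr_ge0 // lt_def x_neq0 // x_ge0.
Qed.

Lemma simplex_trajectory (R : realType) (m : nat)
    (P : 'I_m -> 'I_m -> 'I_m -> R) (x0 : 'rV[R]_m) (n : nat) :
  qso_coefficients P -> simplex x0 -> simplex (trajectory P x0 n).
Proof. by move=> hP Sx0; elim: n => //= n; apply: qso_simplex. Qed.

(** The four cases for the position of the parents relative to A, in one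
    formula: writing them with indicators lets the bound be summed against
    x_i * x_j as a combination of products of single sums. *)
Lemma offspring_in_le (R : realType) (m : nat) (A : {pred 'I_m})
    (P : 'I_m -> 'I_m -> 'I_m -> R) (q : R) (i j : 'I_m) :
  qso_coefficients P -> volterra_on A P ->
  (forall k j, k \in A -> j \notin A -> 2 * P j k k <= q) ->
  2 * \sum_(k in A) P i j k <=
    2 * ((i \in A)%:R * (j \in A)%:R)
    + q * ((i \in A)%:R * (j \notin A)%:R + (i \notin A)%:R * (j \in A)%:R).
Proof.
move=> [P_ge0 P_sym P_sum1] hV hq.
case: (boolP (i \in A)) => Ai; case: (boolP (j \in A)) => Aj /=.
- have : \sum_(k in A) P i j k <= 1.
    by rewrite -(P_sum1 i j) [leRHS](bigID (mem A)) /= lerDl sumr_ge0.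
  by move=> ?; lra.
- rewrite (bigD1 i) //= big1 => [|k /andP[Ak ki]].
    by have := hq i j Ai Aj; rewrite P_sym => ?; lra.
  by apply: hV => //; apply: contraNneq Aj => <-.
- rewrite (bigD1 j) //= big1 => [|k /andP[Ak kj]].
    by have := hq j i Aj Ai => ?; lra.
  by apply: hV => //; apply: contraNneq Ai => <-.
- rewrite big1 => [|k Ak]; first by lra.
  by apply: hV => //; [apply: contraNneq Ai|apply: contraNneq Aj] => <-.
Qed.

Lemma mass_qsoE (R : realType) (m : nat) (A : {pred 'I_m})
    (P : 'I_m -> 'I_m -> 'I_m -> R) (x : 'rV[R]_m) :
  mass A (qso P x) =
  \sum_(i < m) \sum_(j < m) (\sum_(k in A) P i j k) * (x 0 i * x 0 j).
Proof.
rewrite /mass; under eq_bigr do rewrite mxE.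
rewrite exchange_big; apply: eq_bigr => i _ /=.
rewrite exchange_big; apply: eq_bigr => j _ /=.
by rewrite mulr_suml; apply: eq_bigr => k _; rewrite mulrA.
Qed.

Lemma sum_indicator_mul (R : realType) (m : nat) (a b : pred 'I_m)
    (x : 'rV[R]_m) :
  \sum_(i < m) \sum_(j < m) ((a i)%:R * (b j)%:R) * (x 0 i * x 0 j) =
  (\sum_(i | a i) x 0 i) * (\sum_(j | b j) x 0 j).
Proof.
rewrite (big_mkcond a) (big_mkcond b) /= big_distrlr /=.
apply: eq_bigr => i _; apply: eq_bigr => j _.
by case: (a i); case: (b j); rewrite ?mul1r ?mul0r ?mulr0 ?mul0r.
Qed.

(** Pairs with both parents in A contribute at most X^2, mixed pairs at most
    q X (1 - X) altogether, and the remaining pairs nothing. *)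
Lemma mass_qso_le (R : realType) (m : nat) (A : {pred 'I_m})
    (P : 'I_m -> 'I_m -> 'I_m -> R) (q : R) (x : 'rV[R]_m) :
  qso_coefficients P -> volterra_on A P ->
  (forall k j, k \in A -> j \notin A -> 2 * P j k k <= q) -> simplex x ->
  mass A (qso P x) <= mass A x * (mass A x + q * (1 - mass A x)).
Proof.
move=> hP hV hq Sx; have [x_ge0 _] := Sx.
rewrite -(ler_pM2l (ltr0n R 2)) mass_qsoE.
have -> : 2 * (mass A x * (mass A x + q * (1 - mass A x))) =
    2 * (mass A x * mass A x)
    + q * (mass A x * (1 - mass A x) + (1 - mass A x) * mass A x) by ring.
(* Each product of masses becomes a double sum over parents, so that the
   inequality can be proved pair by pair. *)
rewrite -mass_predC // /mass -!sum_indicator_mul -big_split /= !mulr_sumr.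
rewrite -big_split; apply: ler_sum => i _ /=.
rewrite -big_split /= !mulr_sumr -big_split; apply: ler_sum => j _ /=.
rewrite -mulrDl !mulrA -!mulrDl -!mulrA.
by rewrite mulrA ler_wpM2r ?mulr_ge0 // offspring_in_le.
Qed.

(** Since q < 1, the factor of [mass_qso_le] is nondecreasing in the mass, so a
    mass that has not grown since the start keeps it below its initial value. *)
Lemma mass_trajectory_le (R : realType) (m : nat) (A : {pred 'I_m})
    (P : 'I_m -> 'I_m -> 'I_m -> R) (q : R) (x0 : 'rV[R]_m) (n : nat) :
  qso_coefficients P -> volterra_on A P -> 0 <= q < 1 ->
  (forall k j, k \in A -> j \notin A -> 2 * P j k k <= q) -> simplex x0 ->
  mass A (trajectory P x0 n) <=
    mass A x0 * (mass A x0 + q * (1 - mass A x0)) ^+ n.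
Proof.
move=> hP hV /andP[q_ge0 q_lt1] hq Sx0.
set X0 := mass A x0; set theta := X0 + q * (1 - X0).
have X0_ge0 : 0 <= X0 by exact: mass_ge0.
have X0_le1 : X0 <= 1 by exact: mass_le1.
have theta_ge0 : 0 <= theta by rewrite addr_ge0 // mulr_ge0 // subr_ge0.
have theta_le1 : theta <= 1 by rewrite /theta; nra.
elim: n => [|n IHn]; first by rewrite expr0 mulr1.
have Sxn := simplex_trajectory n hP Sx0.
apply: (le_trans (mass_qso_le hP hV hq Sxn)).
have Xn_ge0 := mass_ge0 A Sxn.
have Xn_le : mass A (trajectory P x0 n) <= X0.
  by rewrite (le_trans IHn) // ler_piMr // exprn_ile1.
have factor_le : mass A (trajectory P x0 n)
    + q * (1 - mass A (trajectory P x0 n)) <= theta by rewrite /theta; nra.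
rewrite exprSr mulrA (le_trans (ler_wpM2l Xn_ge0 factor_le)) //.
exact: ler_wpM2r.
Qed.

(** Finitely many numbers below 1 have a common bound below 1; truncating at 0
    keeps it nonnegative even when there are none. *)
Lemma bounded_away_from_1 (R : realType) (I : finType) (p : pred I)
    (f : I -> R) :
  (forall i, p i -> f i < 1) ->
  exists2 q, 0 <= q < 1 & forall i, p i -> f i <= q.
Proof.
move=> f_lt1; exists (\big[Num.max/0]_(i | p i) f i); last first.
  by move=> i pi; exact: le_bigmax_cond.
by rewrite bigmax_ge_id /=; apply/bigmax_ltP; split.
Qed.

Theorem theorem6 (R : realType) (m l r : nat)
    (P : 'I_m -> 'I_m -> 'I_m -> R)
    (hP : qso_coefficients P)
    (hl : (1 <= l <= m)%N)
    (hV : l_volterra l P)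
    (hr : (1 <= r <= l)%N) (hrm : (r < m)%N)
    (ha : forall k i : 'I_m, (k < r)%N -> (r <= i)%N -> assoc_coef P k i < 0)
    (x0 : 'rV[R]_m) (hx0 : int_simplex x0)
    (i : 'I_m) (hi : (i < r)%N) :
  (trajectory P x0 n 0 i @[n --> \oo] --> (0 : R)) /\
  exists C theta : R,
    [/\ 0 < C, 0 <= theta < 1 &
        forall n : nat, (1 <= n)%N -> trajectory P x0 n 0 i <= C * theta ^+ n].
Proof.
pose A : {pred 'I_m} := [pred k : 'I_m | (k < r)%N].
have hVA : volterra_on A P.
  move=> k kr; apply: (proj1 hV); apply: (leq_trans kr).
  by case/andP: hr.
have [q q01 hq] : exists2 q : R, 0 <= q < 1 &
    forall k j, k \in A -> j \notin A -> 2 * P j k k <= q.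
  have [|q q01 hq] := @bounded_away_from_1 R ('I_m * 'I_m)%type
    [pred c | (c.1 \in A) && (c.2 \notin A)] (fun c => 2 * P c.2 c.1 c.1).
    move=> [k j] /= /andP[Ak Aj].
    have kj : (k == j) = false by apply: contraNF Aj => /eqP <-.
    have := ha k j Ak; rewrite leqNgt => /(_ Aj).
    (* Here the coefficient is a_{kj} = 2 P_{jk,k} - 1. *)
    by rewrite /assoc_coef kj; lra.
  by exists q => // k j Ak Aj; apply: (hq (k, j)); rewrite /= Ak.
have Sx0 : simplex x0 by case: hx0.
have X0_ge0 := mass_ge0 A Sx0.
have X0_lt1 : mass A x0 < 1.
  by apply: (@int_simplex_mass_lt1 _ _ _ _ (Ordinal hrm)); rewrite ?inE ?ltnn.
set theta := mass A x0 + q * (1 - mass A x0).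
have theta01 : 0 <= theta < 1.
  by move: q01 => /andP[q_ge0 q_lt1]; rewrite /theta; apply/andP; split; nra.
have decay n : trajectory P x0 n 0 i <= theta ^+ n.
  have Sxn := simplex_trajectory n hP Sx0.
  apply: (le_trans (@coord_le_mass _ _ A _ i Sxn hi)).
  apply: (le_trans (mass_trajectory_le n hP hVA q01 hq Sx0)).
  by rewrite ler_piMl ?exprn_ge0 ?(ltW X0_lt1) //; case/andP: theta01.
split; last first.
  by exists 1, theta; split => // n _; rewrite mul1r.
apply: (@squeeze_cvgr _ _ _ _ (fun=> 0) (fun n => theta ^+ n)).
- apply: nearW => n; rewrite decay andbT.
  by have [xn_ge0 _] := simplex_trajectory n hP Sx0.
- exact: cvg_cst.
- by apply: cvg_expr; case/andP: theta01 => ? ?; rewrite ger0_norm.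
Qed.
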